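(* Let $F$ be a field, $M$ a finite monoid and $N$ a submonoid of $M$. If $(\pi,V)$ is a representation of $N$ over $F$ and $(\sigma,W)$ is a representation of $M$ over $F$, then $$\mathrm{Hom}_M(W,\mathrm{Ind}_N^M V)\cong \mathrm{Hom}_N(W,V)$$ as $F$-vector spaces.
   Context: A representation $(\pi,V)$ of a monoid $N$ over $F$ is an $F$-vector space $V$ together with a monoid homomorphism $\pi:N\to\mathrm{End}_F(V)$ (in particular $\pi(1)=\mathrm{id}_V$). A submonoid $N$ of $M$ contains the identity element of $M$. For a representation $(\pi,V)$ of $N$, the induced representation $(\pi^M,\mathrm{Ind}_N^M V)$ of $M$ is the vector space $$\mathrm{Ind}_N^M V=\{f:M\to V : f(nm)=\pi(n)f(m)\ \text{for all } n\in N,\ m\in M\}$$ with $M$ acting by $(\pi^M(m)f)(x)=f(xm)$ for $m,x\in M$. $\mathrm{Hom}_M$ and $\mathrm{Hom}_N$ denote the $F$-vector spaces of $F$-linear maps commuting with the actions of $M$ and of $N$, respectively; in $\mathrm{Hom}_N(W,V)$, $W$ is regarded as a representation of $N$ by restricting $\sigma$ to $N$. *)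

(* Defs.v *)
From HB Require Import structures.
From mathcomp Require Import all_boot all_algebra.
From mathcomp Require Import boolp functions.

Set Implicit Arguments.
Unset Strict Implicit.
Unset Printing Implicit Defensive.

Import GRing.Theory.
Local Open Scope ring_scope.

#[short(type="finMonoidType")]
HB.structure Definition FinMonoid := {M of Monoid M & Finite M}.

(* The space V is a parameter, so that the pair (pi, V) is V together with an
   element of [representation N V]; End_F(V) is {linear V -> V} under \o.
   V is not assumed finite-dimensional. *)
Record representation (F : fieldType) (N : monoidType) (V : lmodType F) :=
  Representation {
    rep_fun :> N -> {linear V -> V};
    rep1 : rep_fun 1%g =1 idfun;
    repM : forall n m : N, rep_fun (n * m)%g =1 rep_fun n \o rep_fun m
  }.

Section RepHom.
Variables (F : fieldType) (N : monoidType) (W V : lmodType F).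
Variables (sigma : representation N W) (pi : representation N V).

(* [`[< P >]] is the classical truth value of P; it makes Hom a subspace (subtype
   with the inherited F-module structure) of the functions W -> V with pointwise
   operations. [induced] below is obtained in the same way from M -> V. *)
Definition rep_hom_pred : {pred W -> V} := fun f =>
  `[< linear f /\ forall (n : N) (w : W), f (sigma n w) = pi n (f w) >].

Record rep_hom :=
  RepHom { rep_hom_fun :> W -> V; _ : rep_hom_fun \in rep_hom_pred }.

HB.instance Definition _ := [isSub for rep_hom_fun].
HB.instance Definition _ := [Choice of rep_hom by <:].

Lemma rep_hom_submod_closed : submod_closed rep_hom_pred.
Proof.
split=> [|a f g /asboolP[lf cf] /asboolP[lg cg]]; apply/asboolP; split.
- by move=> a u v; rewrite /= scaler0 addr0.
- by move=> n w; rewrite /= linear0.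
- move=> b u v.
  rewrite -![(a *: f + g) _]/(a *: f _ + g _) lf lg !scalerDr !scalerA.
  by rewrite [a * b]mulrC addrACA.
- by move=> n w; rewrite -![(a *: f + g) _]/(a *: f _ + g _) cf cg linearP.
Qed.

HB.instance Definition _ :=
  GRing.isSubmodClosed.Build F (W -> V) rep_hom_pred rep_hom_submod_closed.
HB.instance Definition _ := [SubChoice_isSubZmodule of rep_hom by <:].
HB.instance Definition _ := [SubZmodule_isSubLmodule of rep_hom by <:].

Lemma rep_hom_linear (f : rep_hom) : linear f.
Proof. by have /asboolP[] := valP f. Qed.

HB.instance Definition _ (f : rep_hom) :=
  GRing.isLinear.Build F W V *:%R f (rep_hom_linear f).

Lemma rep_homJ (f : rep_hom) (n : N) (w : W) : f (sigma n w) = pi n (f w).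
Proof. by have /asboolP[_] := valP f. Qed.

End RepHom.

Section Restriction.
Variables (F : fieldType) (M : monoidType) (S : pred M) (N : subMonoidType S).
Variables (W : lmodType F) (sigma : representation M W).

Definition res_fun (n : N) : {linear W -> W} := sigma (val n).

Lemma res_fun1 : res_fun 1%g =1 idfun.
Proof. by move=> w; rewrite /res_fun val1 rep1. Qed.

Lemma res_funM (n m : N) : res_fun (n * m)%g =1 res_fun n \o res_fun m.
Proof. by move=> w; rewrite /res_fun valM repM. Qed.

Definition res_rep : representation N W := Representation res_fun1 res_funM.

End Restriction.

Section Induction.
Variables (F : fieldType) (M : monoidType) (S : pred M) (N : subMonoidType S).
Variables (V : lmodType F) (pi : representation N V).

Definition ind_pred : {pred M -> V} := fun f =>
  `[< forall (n : N) (m : M), f (val n * m)%g = pi n (f m) >].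

Record induced := Induced { ind_fun :> M -> V; _ : ind_fun \in ind_pred }.

HB.instance Definition _ := [isSub for ind_fun].
HB.instance Definition _ := [Choice of induced by <:].

Lemma ind_submod_closed : submod_closed ind_pred.
Proof.
split=> [|a f g /asboolP cf /asboolP cg]; apply/asboolP => n m.
- by rewrite /= linear0.
- by rewrite -![(a *: f + g) _]/(a *: f _ + g _) cf cg linearP.
Qed.

HB.instance Definition _ :=
  GRing.isSubmodClosed.Build F (M -> V) ind_pred ind_submod_closed.
HB.instance Definition _ := [SubChoice_isSubZmodule of induced by <:].
HB.instance Definition _ := [SubZmodule_isSubLmodule of induced by <:].

Lemma ind_act_subproof (m : M) (f : induced) :
  (fun x : M => f (x * m)%g) \in ind_pred.
Proof.
by have /asboolP cf := valP f; apply/asboolP => n x /=; rewrite -mulgA cf.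
Qed.

Definition ind_act (m : M) (f : induced) : induced :=
  Induced (ind_act_subproof m f).

Lemma ind_act_linear (m : M) : linear (ind_act m).
Proof. by move=> a f g; apply/val_inj/funext. Qed.

HB.instance Definition _ (m : M) :=
  GRing.isLinear.Build F induced induced *:%R (ind_act m) (ind_act_linear m).

Lemma ind_act1 : ind_act 1%g =1 idfun.
Proof. by move=> f; apply/val_inj/funext => x /=; rewrite mulg1. Qed.

Lemma ind_actM (m p : M) : ind_act (m * p)%g =1 ind_act m \o ind_act p.
Proof. by move=> f; apply/val_inj/funext => x /=; rewrite mulgA. Qed.

Definition ind_rep : representation M induced :=
  @Representation F M induced (fun m => ind_act m : {linear induced -> induced})
    ind_act1 ind_actM.

End Induction.

(* Main.v *)
(* Frobenius reciprocity: evaluation at the identity, f |-> (w |-> f w 1), has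
   inverse g |-> (w |-> (m |-> g (sigma m w))), since M-equivariance forces
   f w m = f (sigma m w) 1. *)

Require Import Defs.
From HB Require Import structures.
From mathcomp Require Import all_boot all_algebra.
From mathcomp Require Import boolp functions.

Set Implicit Arguments.
Unset Strict Implicit.
Unset Printing Implicit Defensive.

Import GRing.Theory.
Local Open Scope ring_scope.

(** An M-map into functions on M loses nothing when evaluated at 1, since right translation by m
    carries the value at m to 1 ([frobeniusK]); conversely any N-map is recovered because [sigma 1]
    is the identity ([frobenius_invK]). The condition defining Ind, read at 1, is N-equivariance.
    Evaluation is linear as operations are pointwise. *)

Section Frobenius.
Variables (F : fieldType) (M : monoidType) (S : pred M) (N : subMonoidType S).
Variables (V : lmodType F) (pi : representation N V).
Variables (W : lmodType F) (sigma : representation M W).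

Lemma frobenius_subproof (f : rep_hom sigma (ind_rep pi)) :
  (fun w => f w 1%g) \in rep_hom_pred (res_rep N sigma) pi.
Proof.
apply/asboolP; split=> [a u v|n w]; first by rewrite linearP.
have /asboolP cfw := valP (f w).
(* M-equivariance yields [f w (1 * val n)]; the unit is moved to the right of [val n], where left
   N-equivariance of [f w] applies. *)
by rewrite /= /res_fun rep_homJ /= mul1g -[val n]mulg1 cfw.
Qed.

Definition frobenius f := RepHom (frobenius_subproof f).

Lemma frobenius_linear : linear frobenius.
Proof. by move=> a f g; apply/val_inj/funext. Qed.

HB.instance Definition _ :=
  GRing.isLinear.Build F (rep_hom sigma (ind_rep pi))
    (rep_hom (res_rep N sigma) pi) *:%R frobenius frobenius_linear.

Section Inverse.
Variable g : rep_hom (res_rep N sigma) pi.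

(** [sigma (val n * m)] splits off [sigma (val n)], which is the restricted action that [g]
    intertwines with [pi n]. *)
Lemma frobenius_inv_ind (w : W) : (fun m => g (sigma m w)) \in ind_pred pi.
Proof. by apply/asboolP => n m; rewrite repM -rep_homJ. Qed.

Lemma frobenius_inv_subproof :
  (fun w => Induced (frobenius_inv_ind w)) \in rep_hom_pred sigma (ind_rep pi).
Proof.
apply/asboolP; split=> [a u v|m w]; apply/val_inj/funext => x /=.
  by rewrite !linearP.
(* Both sides are [g] at [sigma (x * m) w]: translating the argument by m matches acting on w
   first. *)
by rewrite repM.
Qed.

Definition frobenius_inv := RepHom frobenius_inv_subproof.

End Inverse.

Lemma frobeniusK : cancel frobenius frobenius_inv.
Proof.
move=> f; apply/val_inj/funext => w; apply/val_inj/funext => m /=.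
by rewrite rep_homJ /= mul1g.
Qed.

Lemma frobenius_invK : cancel frobenius_inv frobenius.
Proof. by move=> g; apply/val_inj/funext => w /=; rewrite rep1. Qed.

End Frobenius.

Theorem theorem3p1 (F : fieldType) (M : finMonoidType) (S : pred M)
    (N : subMonoidType S) (V : lmodType F) (pi : representation N V)
    (W : lmodType F) (sigma : representation M W) :
  exists Phi : {linear rep_hom sigma (ind_rep pi) -> rep_hom (res_rep N sigma) pi},
    bijective Phi.
Proof.
exists (@frobenius F M S N V pi W sigma).
exact: Bijective (@frobeniusK _ _ _ _ _ _ _ _) (@frobenius_invK _ _ _ _ _ _ _ _).
Qed.
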